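(* Let $n_1,n_2$ be integers with $n_1\geq n_2+2\geq 3$. Let $H$ and $T$ be graphs with $|H|\geq 1$ and $|T|\geq 0$. Put $$G_1=H\vee(P_{n_1}\cup P_{n_2}\cup T),\qquad G_2=H\vee(P_{n_1-1}\cup P_{n_2+1}\cup T).$$ Then $\rho(G_1)>\rho(G_2)$.
   Context: All graphs are finite, undirected and simple. $|G|$ denotes the number of vertices of $G$ (so $|T|\geq 0$ means that $T$ is allowed to be the graph with no vertices). $P_n$ is the path on $n$ vertices. $G\cup G'$ denotes the disjoint union of graphs, and $G\vee G'$ denotes the join, obtained from the disjoint union $G\cup G'$ by adding all edges between vertices of $G$ and vertices of $G'$. The spectral radius $\rho(G)$ is the largest eigenvalue of the adjacency matrix of $G$. *)

(* Defs.v *)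
From HB Require Import structures.
From mathcomp Require Import all_boot all_order all_algebra.
From mathcomp Require Import complex polyrcf.
From mathcomp Require Import boolp classical_sets reals.

Set Implicit Arguments.
Unset Strict Implicit.
Unset Printing Implicit Defensive.

Import Order.TTheory GRing.Theory Num.Theory.

Local Open Scope ring_scope.

Record sgraph := SGraph {
  vertex :> finType;
  adj : rel vertex;
  adj_sym : symmetric adj;
  adj_irr : irreflexive adj }.

Section Path.
Variable n : nat.

Definition path_adj : rel 'I_n :=
  fun i j => (i.+1 == j :> nat) || (j.+1 == i :> nat).

Fact path_adj_sym : symmetric path_adj.
Proof. by move=> i j; rewrite /path_adj orbC. Qed.

Fact path_adj_irr : irreflexive path_adj.
Proof. by move=> i; rewrite /path_adj orbb -[i.+1]addn1 -[X in _ == X]addn0 eqn_add2l. Qed.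

Definition path_graph : sgraph := SGraph path_adj_sym path_adj_irr.
End Path.

Section UnionJoin.
Variables G G' : sgraph.

Definition union_adj : rel (G + G')%type := fun x y =>
  match x, y with
  | inl u, inl v => adj u v
  | inr u, inr v => adj u v
  | _, _ => false
  end.

Fact union_adj_sym : symmetric union_adj.
Proof. by case=> x [] y //=; rewrite adj_sym. Qed.

Fact union_adj_irr : irreflexive union_adj.
Proof. by case=> x /=; rewrite adj_irr. Qed.

Definition graph_union : sgraph := SGraph union_adj_sym union_adj_irr.

Definition join_adj : rel (G + G')%type := fun x y =>
  match x, y with
  | inl u, inl v => adj u v
  | inr u, inr v => adj u v
  | _, _ => true
  end.

Fact join_adj_sym : symmetric join_adj.
Proof. by case=> x [] y //=; rewrite adj_sym. Qed.

Fact join_adj_irr : irreflexive join_adj.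
Proof. by case=> x /=; rewrite adj_irr. Qed.

Definition graph_join : sgraph := SGraph join_adj_sym join_adj_irr.
End UnionJoin.

Section SpectralRadius.
Variables (R : realType) (G : sgraph).

(* Vertices are numbered by [enum_val]; the eigenvalues do not depend on the
   numbering. *)
Definition adj_matrix : 'M[R]_#|G| :=
  \matrix_(i, j) (adj (enum_val i) (enum_val j))%:R.

(* By [spectral_radius_max] below, this supremum is the largest eigenvalue as
   soon as G has a vertex. *)
Definition spectral_radius : R :=
  sup [set a : R | eigenvalue adj_matrix a]%classic.

Lemma ex_eigenvalue : (0 < #|G|)%N ->
  exists a : R, eigenvalue adj_matrix a.
Proof.
move=> G0; pose A := map_mx (real_complex R) adj_matrix.
have AT i j : A i j = A j i by rewrite !mxE adj_sym.
have Areal i j : (A i j)^* = A i j by rewrite !mxE rmorph_nat rmorph_nat.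
have /closed_rootP[z rz] : size (char_poly A) != 1.
  by rewrite size_char_poly; case: #|G| G0.
have : eigenvalue A z by rewrite eigenvalue_root_char.
case/eigenvalueP => v vA v0.
have E j : \sum_i v 0 i * A i j = z * v 0 j.
  by move/rowP/(_ j): vA; rewrite !mxE.
pose N := \sum_j v 0 j * (v 0 j)^*.
have N0 : N != 0.
  apply: contraNneq v0 => /psumr_eq0P N0; apply/eqP/rowP => j; rewrite mxE.
  apply/eqP; rewrite -mul_conjC_eq0 N0 // => i _.
  by rewrite mul_conjC_ge0.
have zN : z * N = \sum_j \sum_i v 0 i * A i j * (v 0 j)^*.
  rewrite mulr_sumr; apply: eq_bigr => j _.
  by rewrite -mulr_suml E mulrA.
have NC : N^* = N.
  rewrite rmorph_sum; apply: eq_bigr => j _.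
  by rewrite rmorphM /= conjCK mulrC.
have zNC : (z * N)^* = z * N.
  rewrite zN rmorph_sum exchange_big /=; apply: eq_bigr => j _.
  rewrite rmorph_sum; apply: eq_bigr => i _.
  rewrite !rmorphM /= conjCK Areal AT.
  by rewrite -mulrA mulrC; congr (_ * _); rewrite mulrC.
have /CrealP/RRe_real zE : z^* = z.
  by apply: (mulIf N0); rewrite -zNC rmorphM /= NC.
exists (complex.Re z); rewrite eigenvalue_root_char.
by move: rz; rewrite -zE -map_char_poly fmorph_root.
Qed.

Lemma spectral_radius_max : (0 < #|G|)%N ->
  eigenvalue adj_matrix spectral_radius /\
  (forall a, eigenvalue adj_matrix a -> a <= spectral_radius).
Proof.
move=> G0; have [a0 Aa0] := ex_eigenvalue G0.
pose s := rootsR (char_poly adj_matrix).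
have sE a : (a \in s) = eigenvalue adj_matrix a.
  rewrite eigenvalue_root_char -roots_on_rootsR ?in_itv //.
  by rewrite monic_neq0 ?char_poly_monic.
pose m := \big[Num.max/a0]_(a <- s) a.
have ms : eigenvalue adj_matrix m.
  rewrite /m big_seq; elim/big_ind: _ => // [x y Ax Ay|a].
    by rewrite maxEle; case: ifP.
  by rewrite sE.
have sm a : eigenvalue adj_matrix a -> a <= m.
  by rewrite -sE => a_s; apply: le_bigmax_seq.
suff -> : spectral_radius = m by [].
apply/le_anti/andP; split; first by apply: ge_sup; [exists a0 | move=> a /sm].
by apply: ub_le_sup => //; exists m => a /sm.
Qed.
End SpectralRadius.

(* Main.v *)
Require Import Defs.
From mathcomp Require Import all_boot all_order all_algebra.
From mathcomp Require Import reals.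
From mathcomp Require Import complex ring lra zify.
Import Order.TTheory GRing.Theory Num.Theory.
Local Open Scope ring_scope.

(** The largest eigenvalue of a symmetric matrix [A] is the least [x] such that the
    quadratic form [f^T (A - x) f], called the excess of [f] at [x] below, is
    nowhere positive ([rayleigh_quotient_le], [adj_form_le]). So, with
    [r] the spectral radius of [G2], it is enough to find a vector on [G1] whose
    excess at [r] is positive.

    Such a vector is obtained by altering one on [G2]. In either graph, a
    path component [P_n] meets the rest only through the join with [H], so it feels
    only the total weight [s] that the vector has on [H], and contributes
    [2 s (1^T p) - p^T (x - A) p] to the excess, [p] being the restriction to the
    path and [A] its adjacency matrix. For [x >= 2] the matrix [x - A] is positive
    definite, and the largest possible contribution is [s ^ 2 W_n] with
    [W_n = 1^T (x - A)^-1 1] ([path_le], [path_max]). The sequence [W_n]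
    is strictly convex ([path_total_convex]): appending a vertex raises it by
    [(1 + e_n) e_{n+1}], where [e_n] is the last entry of [(x - A)^-1 1], and
    [e_n] increases with the length. Hence
    [W_{n1} + W_{n2} > W_{n1-1} + W_{n2+1}] as [n1 - 1 > n2].

    Take therefore a vector on [G2] with nonnegative excess at [r] and with [s > 0]
    ([join_top_vector]), keep it on [H] and [T], and put the best possible vectors
    on the two paths of [G1]: the excess becomes positive. The
    condition [r >= 2] holds because [G2] contains a triangle, made of a vertex of
    [H] and two neighbours on the path [P_{n1-1}]. *)

Set Implicit Arguments.
Unset Strict Implicit.
Unset Printing Implicit Defensive.

(** * The Rayleigh quotient of a real symmetric matrix *)

Section Rayleigh.
Local Open Scope sesquilinear_scope.

(** Diagonalising [A] over the complex numbers as [A = P^-1 D P] with [P] unitary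
    turns both sides into sums of squared moduli, weighted on the left by
    the eigenvalues and on the right by [r]. *)
Lemma rayleigh_quotient_le (R : realType) n (A : 'M[R]_n) (r : R) (v : 'rV[R]_n) :
    A^T = A -> (forall a, eigenvalue A a -> a <= r) ->
  (v *m A *m v^T) 0 0 <= r * (v *m v^T) 0 0.
Proof.
move=> Asym Ar; pose toC := real_complex R; pose B := map_mx toC A.
have toCc a : (toC a)^* = toC a by exact: conjc_real.
have Bherm : B \is hermsymmx.
  apply: realsym_hermsym; last first.
    by apply/mxOverP => i j; rewrite mxE; apply/CrealP.
  by apply/is_hermitianmxP; rewrite scale1r map_mx_id // map_trmx Asym.
have Breal := hermitian_spectral_diag_real Bherm.
have /hermitian_normalmx/orthomx_spectralP BE := Bherm.
have Punit := spectral_unitarymx B.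
set P := spectralmx B in BE Punit; set d := spectral_diag B in BE Breal.
have PU := unitarymx_unit Punit.
have dr j : d 0 j <= toC r.
  (* The eigenvalues of [B] are real, hence are eigenvalues of [A]. *)
  have dj : toC (complex.Re (d 0 j)) = d 0 j.
    by apply: RRe_real; apply: (mxOverP Breal).
  have PB : P *m B = diag_mx d *m P by rewrite {1}BE -!mulmxA mulKVmx.
  have : eigenvalue B (d 0 j).
    apply/eigenvalueP; exists (row j P).
      by rewrite -row_mul PB row_mul row_diag_mx -scalemxAl -rowE.
    apply: contraTneq PU => rP; rewrite -row_free_unit.
    by apply/row_freePn; exists j; rewrite rP sub0mx.
  rewrite -dj eigenvalue_root_char -map_char_poly fmorph_root -eigenvalue_root_char.
  by move=> /Ar; rewrite lecR.
(* [y] holds the coordinates of [v] in the orthonormal eigenbasis. *)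
pose w := map_mx toC v; pose y := w *m P^t*.
have wT : w^t* = map_mx toC v^T.
  by apply/matrixP => i j; rewrite !mxE toCc.
have yT : y^t* = P *m w^t* by rewrite trmx_mul map_mxM trmxCK.
rewrite -lecR rmorphM /= -/toC.
have -> : toC ((v *m A *m v^T) 0 0) = \sum_j d 0 j * (y 0 j * (y 0 j)^*).
  have -> : toC ((v *m A *m v^T) 0 0) = (y *m diag_mx d *m y^t*) 0 0.
    have -> : y *m diag_mx d *m y^t* = w *m B *m w^t*.
      by rewrite yT BE /y -(invmx_unitary Punit) !mulmxA.
    by rewrite wT -!map_mxM [RHS]mxE.
  rewrite mxE; apply: eq_bigr => j _; rewrite mul_mx_diag !mxE.
  by rewrite mulrAC mulrC.
have -> : toC ((v *m v^T) 0 0) = \sum_j (y 0 j * (y 0 j)^*).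
  have -> : toC ((v *m v^T) 0 0) = (y *m y^t*) 0 0.
    by rewrite yT mulmxA mulmxKtV // wT -map_mxM [RHS]mxE.
  by rewrite mxE; apply: eq_bigr => j _; rewrite !mxE.
rewrite mulr_sumr; apply: ler_sum => j _.
by rewrite ler_wpM2r // mul_conjC_ge0.
Qed.

End Rayleigh.

(** * The extremal problem on a path *)

(** The three sequences below are, for [A] the adjacency matrix of [P_n], the last
    diagonal entry of [(x - A)^-1], the last entry of [(x - A)^-1 1], and
    [1^T (x - A)^-1 1]. The recursions are those given by the Schur complement of
    the last vertex. *)
Fixpoint path_green (R : realFieldType) (x : R) n : R :=
  if n is m.+1 then (x - path_green x m)^-1 else 0.

Fixpoint path_end (R : realFieldType) (x : R) n : R :=
  if n is m.+1 then (1 + path_end x m) * path_green x m.+1 else 0.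

Definition path_total (R : realFieldType) (x : R) n : R :=
  \sum_(m < n) (1 + path_end x m) * path_end x m.+1.

(** [2 s (1^T p) - p^T (x - A) p], with [A] the adjacency matrix of [P_n], vertices
    numbered from [1], and [p 0 = 0]. *)
Definition path_energy (R : realFieldType) (x s : R) n (p : nat -> R) : R :=
  \sum_(i < n) (2 * s * p i.+1 - x * p i.+1 ^+ 2 + 2 * p i * p i.+1).

Section PathEnergy.
Variables (R : realFieldType) (x : R).
Hypothesis x_ge2 : 2 <= x.

Lemma path_greenS n : path_green x n.+1 = (x - path_green x n)^-1.
Proof. by []. Qed.

Lemma path_endS n : path_end x n.+1 = (1 + path_end x n) * path_green x n.+1.
Proof. by []. Qed.

(** If [0 <= g < 1] then [x - g > 1], so the bound propagates along the recursion;
    [2] is exactly the threshold at which this works for every length. *)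
Lemma path_green_bounds n : 0 <= path_green x n < 1.
Proof.
elim: n => [|n /andP[IH0 IH1]] /=; first by rewrite lexx ltr01.
have x1 : 1 < x - path_green x n by move: x_ge2 => x2; lra.
by rewrite invr_ge0 invf_lt1 ?(lt_trans ltr01) // x1 ltW // (lt_trans ltr01).
Qed.

Lemma path_green_gap n : 0 < x - path_green x n.
Proof. by move: x_ge2 (path_green_bounds n) => x2 /andP[_ g1]; lra. Qed.

Lemma path_green_gt0 n : 0 < path_green x n.+1.
Proof. by rewrite invr_gt0 path_green_gap. Qed.

Lemma path_green_lt n : path_green x n < path_green x n.+1.
Proof.
elim: n => [|n IH]; first exact: path_green_gt0.
have gap := path_green_gap; rewrite (path_greenS n) (path_greenS n.+1).
rewrite ltf_pV2 ?posrE //.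
by rewrite ltrD2l ltrN2.
Qed.

Lemma path_end_ge0 n : 0 <= path_end x n.
Proof.
by elim: n => //= n IH; rewrite mulr_ge0 ?addr_ge0 // ltW // path_green_gt0.
Qed.

Lemma path_end_lt n : path_end x n < path_end x n.+1.
Proof.
elim: n => [|n IH].
  by rewrite mulr_gt0 ?path_green_gt0 // addr0.
rewrite !(path_endS n, path_endS n.+1); apply: ltr_pM.
- by rewrite addr_ge0 ?path_end_ge0.
- exact/ltW/path_green_gt0.
- by rewrite ltrD2l.
- exact: path_green_lt.
Qed.

Lemma path_end_homo : {homo path_end x : m n / (m < n)%N >-> m < n}.
Proof. by apply: homo_ltn; [exact: lt_trans | exact: path_end_lt]. Qed.

Lemma path_totalS n :
  path_total x n.+1 = path_total x n + (1 + path_end x n) * path_end x n.+1.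
Proof. by rewrite /path_total big_ord_recr. Qed.

(** The increment [(1 + path_end n) * path_end n.+1] grows with [n] because
    [path_end] does, and [path_end] inherits this from [path_green]. *)
Lemma path_total_convex a b : (a < b)%N ->
  path_total x b + path_total x a.+1 < path_total x b.+1 + path_total x a.
Proof.
move=> ab; rewrite !path_totalS.
have : (1 + path_end x a) * path_end x a.+1 < (1 + path_end x b) * path_end x b.+1.
  apply: ltr_pM; rewrite ?ltrD2l ?path_end_homo ?ltnS //.
    by rewrite addr_ge0 ?path_end_ge0.
  exact: path_end_ge0.
lra.
Qed.

Lemma path_energyS s n p : path_energy x s n.+1 p =
  path_energy x s n p + (2 * s * p n.+1 - x * p n.+1 ^+ 2 + 2 * p n * p n.+1).
Proof. by rewrite /path_energy big_ord_recr. Qed.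

(** The maximum of the energy when the far end of the path is also pushed by [t];
    the extra parameter makes an induction on the number of vertices possible,
    [t] being then the value at the next vertex. *)
Definition path_value s t n : R :=
  s ^+ 2 * path_total x n + 2 * s * t * path_end x n + t ^+ 2 * path_green x n.

(** Completing the square in the value [c] at the new last vertex. *)
Lemma path_valueS s t n c :
  2 * (s + t) * c - x * c ^+ 2 + path_value s c n =
  path_value s t n.+1
    - (x - path_green x n)
      * (c - (s * (1 + path_end x n) + t) * path_green x n.+1) ^+ 2.
Proof.
rewrite /path_value path_totalS /=.
have := path_green_gap n; move: (path_total x n) (path_end x n) (path_green x n).
move=> W e g g0; have {}g0 : x - g != 0 by rewrite gt_eqF.
by field.
Qed.

Lemma path_energy_le s t n p : p 0%N = 0 ->
  path_energy x s n p + 2 * t * p n <= path_value s t n.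
Proof.
move=> p0; elim: n t => [|n IH] t.
  by rewrite /path_energy /path_value /path_total !big_ord0 p0 /= !mulr0 !addr0.
have := path_valueS s t n (p n.+1); rewrite path_energyS.
have : 0 <= (x - path_green x n)
    * (p n.+1 - (s * (1 + path_end x n) + t) * path_green x n.+1) ^+ 2.
  by rewrite mulr_ge0 ?sqr_ge0 // ltW // path_green_gap.
have := IH (p n.+1).
set Q := (x - _) * _; move: Q (path_value _ _ n) (path_value _ _ n.+1).
move: (path_energy _ _ _ _) => *; lra.
Qed.

Lemma path_energy_max s t n : exists2 p, p 0%N = 0 &
  path_energy x s n p + 2 * t * p n = path_value s t n.
Proof.
elim: n t => [|n IH] t.
  exists (fun=> 0) => //.
  by rewrite /path_energy /path_value /path_total !big_ord0 /= !mulr0 !addr0.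
pose c := (s * (1 + path_end x n) + t) * path_green x n.+1.
have [p p0 pE] := IH c.
exists (fun k => if k == n.+1 then c else p k) => //.
rewrite path_energyS eqxx ltn_eqF //.
have -> : path_energy x s n (fun k => if k == n.+1 then c else p k)
        = path_energy x s n p.
  by apply: eq_bigr => i _; rewrite !ltn_eqF // ?ltnS // ltnW // ltnS.
have := path_valueS s t n c; rewrite -/c subrr expr0n mulr0 subr0 => <-.
rewrite -pE; ring.
Qed.
End PathEnergy.

(** * Quadratic forms of graphs *)

Section Forms.
Variable R : realType.

Definition adj_form (G : sgraph) (f : G -> R) : R :=
  \sum_u \sum_v (adj u v)%:R * (f u * f v).

Definition excess (x : R) (G : sgraph) (f : G -> R) : R :=
  adj_form f - x * \sum_u f u ^+ 2.

(** The Rayleigh bound, freed from the numbering of the vertices so that it can be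
    used on unions and joins. *)
Lemma adj_form_le (G : sgraph) (f : G -> R) :
  (0 < #|G|)%N -> adj_form f <= spectral_radius R G * \sum_u f u ^+ 2.
Proof.
move=> /(spectral_radius_max R) [_ rmax].
pose v : 'rV[R]_#|G| := \row_i f (enum_val i).
have Asym : (adj_matrix R G)^T = adj_matrix R G.
  by apply/matrixP => i j; rewrite !mxE adj_sym.
have reindex_enum (F : G -> R) : \sum_u F u = \sum_(i < #|G|) F (enum_val i).
  exact: big_enum_val.
have := rayleigh_quotient_le v Asym rmax; rewrite !mxE.
rewrite /adj_form exchange_big !reindex_enum.
congr (_ <= _ * _); last by apply: eq_bigr => i _; rewrite !mxE expr2.
apply: eq_bigr => j _; rewrite reindex_enum !mxE mulr_suml.
by apply: eq_bigr => i _; rewrite !mxE mulrCA mulrA.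
Qed.

Lemma adj_form_eq (G : sgraph) : (0 < #|G|)%N ->
  exists2 f : G -> R, exists u, f u != 0 &
    adj_form f = spectral_radius R G * \sum_u f u ^+ 2.
Proof.
move=> /(spectral_radius_max R) [/eigenvalueP[v vA v0] _].
exists (fun u => v 0 (enum_rank u)).
  have /rV0Pn[i vi] := v0; exists (enum_val i); by rewrite enum_valK.
rewrite /adj_form exchange_big mulr_sumr; apply: eq_bigr => u _.
move/rowP/(_ (enum_rank u)): vA; rewrite !mxE => vA.
rewrite expr2 mulrA -vA mulr_suml (reindex_onto (@enum_val G predT) enum_rank) /=;
  last by move=> i _; rewrite enum_rankK.
apply: eq_big => [i|i _]; first by rewrite enum_valK eqxx.
by rewrite !mxE enum_rankK enum_valK mulrCA mulrA.
Qed.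

Lemma adj_form_abs (G : sgraph) (f : G -> R) :
  adj_form f <= adj_form (fun u => `|f u|).
Proof.
apply: ler_sum => u _; apply: ler_sum => v _.
by rewrite ler_wpM2l // -normrM ler_norm.
Qed.

Lemma excess_union x (G K : sgraph) (f : graph_union G K -> R) :
  excess x f = excess x (G := G) (f \o inl) + excess x (G := K) (f \o inr).
Proof.
have -> : excess x f = adj_form (G := G) (f \o inl) + adj_form (G := K) (f \o inr)
    - x * (\sum_u f (inl u) ^+ 2 + \sum_u f (inr u) ^+ 2).
  rewrite /excess big_sumType; congr (_ - _).
  rewrite /adj_form big_sumType; congr (_ + _); apply: eq_bigr => u _.
    rewrite big_sumType /= [X in _ + X]big1 ?addr0 // => v _.
    by rewrite mul0r.
  rewrite big_sumType /= big1 ?add0r // => v _.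
  by rewrite mul0r.
by rewrite /excess /=; ring.
Qed.

Lemma excess_join x (G K : sgraph) (f : graph_join G K -> R) :
  excess x f = excess x (G := G) (f \o inl) + excess x (G := K) (f \o inr)
    + 2 * (\sum_u f (inl u)) * (\sum_u f (inr u)).
Proof.
set S := \sum_u f (inl u); set S' := \sum_u f (inr u).
have -> : excess x f =
    (adj_form (G := G) (f \o inl) + S * S') + (S' * S + adj_form (G := K) (f \o inr))
    - x * (\sum_u f (inl u) ^+ 2 + \sum_u f (inr u) ^+ 2).
  rewrite /excess big_sumType; congr (_ - _).
  rewrite /adj_form big_sumType !mulr_suml -!big_split; congr (_ + _);
    apply: eq_bigr => u _; rewrite big_sumType /= mulr_sumr; congr (_ + _);
    by apply: eq_bigr => v _; rewrite mul1r.
by rewrite /excess /=; ring.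
Qed.

(** The constraint [p 0 = 0] puts a fictitious vertex before the path, so that all
    edges have the form [(i, i.+1)] and the first vertex needs no special case. *)
Lemma excess_path x s n (f : path_graph n -> R) (p : nat -> R) :
    p 0%N = 0 -> (forall i : 'I_n, f i = p i.+1) ->
  excess x f + 2 * s * \sum_i f i = path_energy x s n p.
Proof.
move=> p0 fp.
have formE : adj_form f = \sum_(i < n) 2 * p i * p i.+1.
  rewrite /adj_form; under eq_bigr do under eq_bigr do rewrite !fp.
  rewrite /= /path_adj {f fp}; elim: n => [|n IH]; first by rewrite !big_ord0.
  have last_edge : \sum_(i < n) ((i.+1 == n) || (n.+1 == i))%:R * p i.+1 = p n.
    case: {IH} n => [|n]; first by rewrite big_ord0.
    rewrite big_ord_recr /= eqxx mul1r big1 ?add0r // => i _.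
    have -> : (i.+1 == n.+1) || (n.+2 == i) = false by have := ltn_ord i; lia.
    by rewrite mul0r.
  rewrite [RHS]big_ord_recr -IH !big_ord_recr /= gtn_eqF // mul0r addr0.
  under eq_bigr do rewrite big_ord_recr /=.
  rewrite big_split /= -addrA; congr (_ + _).
  transitivity (p n * p n.+1 + p n * p n.+1); last by ring.
  rewrite -last_edge !mulr_suml; congr (_ + _); apply: eq_bigr => i _.
    by rewrite mulrA.
  by rewrite orbC [p n.+1 * _]mulrC mulrA.
rewrite /excess formE /path_energy !mulr_sumr addrAC -big_split -sumrB /=.
by apply: eq_bigr => i _; rewrite !fp; ring.
Qed.

(** Given its total weight [s] on [H], the excess of a vector on the graphs being
    compared splits into a part that does not see the paths and one term for each
    path. *)
Lemma excess_join_paths x (H T : sgraph) a b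
    (f : graph_join H (graph_union (graph_union (path_graph a) (path_graph b)) T)
       -> R) (s := \sum_h f (inl h)) :
  excess x f =
    excess x (fun h => f (inl h)) + excess x (fun t => f (inr (inr t)))
      + 2 * s * (\sum_t f (inr (inr t)))
    + ((excess x (fun i : path_graph a => f (inr (inl (inl i))))
          + 2 * s * \sum_i f (inr (inl (inl i))))
       + (excess x (fun i : path_graph b => f (inr (inl (inr i))))
          + 2 * s * \sum_i f (inr (inl (inr i))))).
Proof.
by rewrite excess_join !excess_union -/s !big_sumType /=; ring.
Qed.

(** The left-hand side is the contribution of a path to the excess in a join whose
    other side has total weight [s]; [path_max] shows the bound to be sharp. *)
Lemma path_le x s n (f : path_graph n -> R) : 2 <= x ->
  excess x f + 2 * s * \sum_i f i <= s ^+ 2 * path_total x n.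
Proof.
move=> x2; pose p k := if k is i.+1 then oapp f 0 (insub i) else 0.
rewrite (@excess_path x s n f p) // => [|i]; last by rewrite /p /= valK.
have := path_energy_le x2 s 0 n (erefl : p 0%N = 0).
by rewrite /path_value !(mulr0, mul0r, expr0n, addr0).
Qed.

Lemma path_max x s n : 2 <= x -> exists f : path_graph n -> R,
  excess x f + 2 * s * \sum_i f i = s ^+ 2 * path_total x n.
Proof.
move=> x2; have [p p0 pE] := path_energy_max x2 s 0 n.
exists (fun i : 'I_n => p i.+1); rewrite (excess_path _ _ p0) //.
by move: pE; rewrite /path_value !(mulr0, mul0r, expr0n, addr0).
Qed.

(** The indicator of a triangle has form [6] and squared norm [3]. *)
Lemma spectral_radius_triangle (G : sgraph) (a b c : G) :
  adj a b -> adj b c -> adj a c -> 2 <= spectral_radius R G.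
Proof.
move=> ab bc ac.
pose f (u : G) : R := (u == a)%:R + (u == b)%:R + (u == c)%:R.
have sum_f (g : G -> R) : \sum_u f u * g u = g a + g b + g c.
  have delta d : \sum_u (u == d)%:R * g u = g d.
    rewrite (bigD1 d) //= eqxx mul1r big1 ?addr0 // => u /negPf->.
    by rewrite mul0r.
  by rewrite -!delta -!big_split; apply: eq_bigr => u _; rewrite !mulrDl.
have ne (u v : G) : adj u v -> (u == v) = false.
  by apply: contraTF => /eqP->; rewrite adj_irr.
have [E1 E2] : adj_form f = 6 /\ \sum_u f u ^+ 2 = 3.
  split.
    transitivity (\sum_u f u * \sum_v f v * (adj u v)%:R).
      by apply: eq_bigr => u _; rewrite mulr_sumr; apply: eq_bigr => v _; ring.
    rewrite sum_f !sum_f !adj_irr (adj_sym b a) (adj_sym c a) (adj_sym c b).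
    by rewrite ab bc ac /=; ring.
  under eq_bigr do rewrite expr2.
  rewrite sum_f /f !eqxx (eq_sym b a) (eq_sym c a) (eq_sym c b).
  by rewrite !ne //=; ring.
have G0 : (0 < #|G|)%N by apply/card_gt0P; exists a.
by have := adj_form_le f G0; rewrite E1 E2; lra.
Qed.

(** The absolute values of an eigenvector for [r] do. If they vanish on [H], then
    giving all of [H] a suitable common weight does not lower the excess, because
    every vertex of [H] sees the whole, positive, weight of [K]. *)
Lemma join_top_vector (H K : sgraph) (r := spectral_radius R (graph_join H K)) :
    (0 < #|H|)%N -> 0 < r ->
  exists2 u : graph_join H K -> R, 0 < \sum_h u (inl h) & 0 <= excess r u.
Proof.
move=> H0 r0; have [h _] := card_gt0P H0.
have [v [a va] vr] : exists2 f : graph_join H K -> R, exists u, f u != 0 &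
    adj_form f = r * \sum_u f u ^+ 2.
  by apply: adj_form_eq; apply/card_gt0P; exists (inl h).
pose w u := `|v u|; have w0 u : 0 <= w u by exact: normr_ge0.
have w_ge0 : 0 <= excess r w.
  rewrite subr_ge0 (le_trans _ (adj_form_abs v)) // vr.
  rewrite le_eqVlt; apply/orP; left; apply/eqP; congr (_ * _).
  by apply: eq_bigr => k _; rewrite real_normK ?num_real.
have [wH0|wH0] := eqVneq (\sum_h w (inl h)) 0; last first.
  by exists w => //; rewrite lt_def wH0 sumr_ge0.
have wH : forall h, w (inl h) = 0.
  by move=> k; apply: (psumr_eq0P _ wH0).
pose S := \sum_k w (inr k).
have S0 : 0 < S.
  case: a va => [k|k] va; first by move: (wH k) => /eqP; rewrite normr_eq0 (negPf va).
  rewrite /S (bigD1 k) //= ltr_wpDr ?sumr_ge0 //.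
  by rewrite normr_gt0.
(* On [H], the value [e] loses at most [r * #|H| * e ^ 2] and gains
   [2 * #|H| * e * S] from the join edges; the choice of [e] balances them. *)
pose e := 2 * S / r; have e0 : 0 < e by rewrite divr_gt0 ?mulr_gt0.
exists (fun u => if u is inr k then w (inr k) else e).
  by rewrite /= sumr_const -mulr_natr mulr_gt0 ?ltr0n.
move: w_ge0; rewrite !excess_join wH0 mulr0 mul0r addr0 /=.
have -> : excess r (G := H) (w \o inl) = 0.
  rewrite /excess /adj_form big1 ?big1 ?mulr0 ?subr0 // => u _ /=.
    by rewrite wH expr0n.
  by rewrite big1 // => k _; rewrite wH mul0r mulr0.
rewrite add0r => wK; rewrite addrAC addr_ge0 //.
have le_H : - r * (#|H|%:R * e ^+ 2) <= excess r (G := H) (fun=> e).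
  rewrite /excess sumr_const mulNr -[e ^+ 2 *+ _]mulr_natl lerDr.
  by apply: sumr_ge0 => u _; apply: sumr_ge0 => k _; rewrite mulr_ge0 // -expr2 sqr_ge0.
rewrite -[X in 0 <= X + _]/(excess r (G := H) (fun=> e)).
apply: le_trans (lerD le_H (lexx _)).
rewrite sumr_const -/S -[e *+ _]mulr_natl.
suff -> : - r * (#|H|%:R * e ^+ 2) + 2 * (#|H|%:R * e) * S = 0 by [].
have r1 : r != 0 by rewrite gt_eqF.
by rewrite /e; field.
Qed.

End Forms.

(** * Comparison of the two joins *)

Theorem lemma1p1 (R : realType) (n1 n2 : nat) (H T : sgraph) :
  (n2 + 2 <= n1)%N -> (3 <= n2 + 2)%N -> (1 <= #|H|)%N ->
  let G1 := graph_join H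
    (graph_union (graph_union (path_graph n1) (path_graph n2)) T) in
  let G2 := graph_join H
    (graph_union (graph_union (path_graph (n1 - 1)) (path_graph (n2 + 1))) T) in
  spectral_radius R G1 > spectral_radius R G2.
Proof.
move=> n12 n2_gt0 H0; lazy zeta.
set G1 := graph_join H (graph_union (graph_union (path_graph n1) _) T).
set G2 := graph_join H _; set r := spectral_radius R G2.
have [h _] := card_gt0P H0.
have r2 : 2 <= r.
  have i0 : (0 < n1 - 1)%N by lia.
  have i1 : (1 < n1 - 1)%N by lia.
  exact: (@spectral_radius_triangle _ G2 (inl h)
    (inr (inl (inl (Ordinal i0)))) (inr (inl (inl (Ordinal i1))))).
have [u uH ur] := join_top_vector H0 (lt_le_trans (ltr0Sn R 1) r2).
set s := \sum_h u (inl h) in uH.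
have [f fE] := path_max s n1 r2; have [g gE] := path_max s n2 r2.
pose w (a : G1) : R := match a with
  | inl k => u (inl k)
  | inr (inr t) => u (inr (inr t))
  | inr (inl (inl i)) => f i
  | inr (inl (inr i)) => g i
  end.
suff /(le_lt_trans ur) : excess r u < excess r w.
  have /(adj_form_le w) : (0 < #|G1|)%N by apply/card_gt0P; exists (inl h).
  rewrite subr_gt0 => wG1 /lt_le_trans/(_ wG1).
  apply: contraTT; rewrite -!leNgt; apply: ler_wpM2r.
  by apply: sumr_ge0 => a _; exact: sqr_ge0.
rewrite [ltLHS]excess_join_paths [ltRHS]excess_join_paths.
(* Off the paths [u] and [w] agree. *)
apply: ler_ltD; first exact: lexx.
apply: le_lt_trans (lerD (path_le s _ r2) (path_le s _ r2)) _.
have n2n1 : (n2 < n1 - 1)%N by lia.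
have := path_total_convex r2 n2n1.
have -> : (n1 - 1).+1 = n1 by lia.
by rewrite -[n2.+1]addn1 -(ltr_pM2l (exprn_gt0 2 uH)) !mulrDr -fE -gE.
Qed.
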